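(* Let $t$ be an integer, let $G$ be a $P_t$-free graph, and let $X,Y\subseteq V(G)$ be disjoint sets such that $X$ is stable and every connected component of $G|Y$ has at most $p$ vertices. Let $\mathcal{Z}$ be a set of subsets of $Y$, each of size $q$, each inducing a connected subgraph of $G$, and each having an attachment in $X$. Let $H$ be the hypergraph with vertex set $X$ and hyperedge set $\{X(Z): Z\in\mathcal{Z}\}$. Then $\lambda(H)\le \binom{p}{q}\left\lceil \frac{t+1}{2}\right\rceil$.
   Context: Graphs are finite and simple; $P_t$ is the path on $t$ vertices, and $G$ is $P_t$-free if it has no induced subgraph isomorphic to $P_t$. $G|A$ denotes the subgraph induced on $A$. A set is stable if no edge has both ends in it. For $A\subseteq V(G)$, an attachment of $A$ is a vertex of $V(G)\setminus A$ with a neighbor in $A$; for $B\subseteq V(G)\setminus A$, $B(A)$ denotes the set of attachments of $A$ that lie in $B$ (so $X(Z)$ is the set of vertices of $X$ having a neighbor in $Z$). A hypergraph $H$ consists of a finite vertex set $V(H)$ and a set $E(H)$ of nonempty subsets of $V(H)$ (hyperedges). $\lambda(H)$ is the maximum $k\ge 2$ such that there are hyperedges $e_1,\dots,e_k\in E(H)$ with the property that for every $1\le i<j\le k$ there is a vertex $v_{i,j}\in V(H)$ with $\{h\in\{1,\dots,k\}: v_{i,j}\in e_h\}=\{i,j\}$; if no such $k$ exists, $\lambda(H)=2$.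
   Formalization: When 𝒵 is empty the claim is assumed only where the bound is at least 2, because λ(H)=2 by convention while the stated bound can be 0 (if q>p) or 1; for nonempty 𝒵 the statement is unchanged. *)

(* Defs.v *)
From HB Require Import structures.
From mathcomp Require Import all_boot.

Set Implicit Arguments.
Unset Strict Implicit.
Unset Printing Implicit Defensive.

(* A finite simple graph is a finite type of vertices together with a symmetric
   irreflexive relation; symmetry and irreflexivity are hypotheses of the
   theorem, so they do not appear in the definitions below. *)
Section Graph.
Variables (V : finType) (e : rel V).
Implicit Types A B Y : {set V}.

Definition path_graph (t : nat) : rel 'I_t :=
  [rel i j : 'I_t | (i.+1 == j :> nat) || (j.+1 == i :> nat)].

Definition has_induced (W : finType) (d : rel W) : Prop :=
  exists2 f : W -> V, injective f & forall i j, e (f i) (f j) = d i j.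

Definition path_free (t : nat) : Prop := ~ has_induced (@path_graph t).

Definition stable A : Prop := {in A &, forall x y, ~~ e x y}.

Definition restr A : rel V := [rel x y | [&& x \in A, y \in A & e x y]].

Definition induces_connected A : Prop :=
  {in A &, forall x y, connect (restr A) x y}.

Definition components A : {set {set V}} :=
  equivalence_partition (connect (restr A)) A.

Definition attachments A : {set V} :=
  [set v | (v \notin A) && [exists u in A, e v u]].

(* B(A) in the usual notation. *)
Definition attach B A : {set V} := B :&: attachments A.

End Graph.

Record hypergraph (V : finType) := Hypergraph {
  hverts : {set V};
  hedges : {set {set V}};
  hedges_sub : forall f, f \in hedges -> f \subset hverts;
  hedges_neq0 : forall f, f \in hedges -> f != set0
}.

Section Lambda.
Variables (V : finType) (H : hypergraph V).

(* The hyperedges are not required to be distinct: for k >= 3 the vertices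
   v_{i,j} force it, and k = 2 never affects the value of lambda. *)
Definition pairwise_witnessed (k : nat) : bool :=
  [exists E : {ffun 'I_k -> {set V}},
    [forall i, E i \in hedges H] &&
    [forall i : 'I_k, forall j : 'I_k, (i < j) ==>
      [exists v in hverts H, [set h | v \in E h] == [set i; j]]]].

(* The alternative k == 2 encodes the default value 2. *)
Definition lambda_cand (k : nat) : bool :=
  (k == 2) || (2 <= k) && pairwise_witnessed k.

Lemma lambda_cand_ex : exists k, lambda_cand k.
Proof. by exists 2. Qed.

Lemma lambda_cand_bounded k : lambda_cand k -> k <= maxn 2 #|hedges H|.
Proof.
case/orP=> [/eqP->|/andP[_ /existsP[E /andP[/forallP EH /forallP w]]]].
  by rewrite leq_maxl.
rewrite leq_max; case: (leqP k 2) => //= k_gt2.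
have ltE (i j : 'I_k) : i < j -> E i != E j.
  move=> lt_ij; apply/eqP => Eij.
  have [l [li lj]] : exists l : 'I_k, l != i /\ l != j.
    have : 0 < #|~: [set i; j]|.
      by rewrite cardsCs setCK card_ord cards2 subn_gt0;
         case: (i != j); rewrite ?(ltnW k_gt2).
    case/card_gt0P=> l; rewrite !inE negb_or => /andP[]; by exists l.
  have wit (a b : 'I_k) : a < b ->
      exists v, forall h, (v \in E h) = (h == a) || (h == b).
    move=> ab; have /forallP/(_ b)/implyP/(_ ab) := w a.
    case/existsP=> v /andP[_ /eqP s]; exists v => h.
    by move/setP/(_ h): s; rewrite !inE.
  have [v wv] : exists v, forall h, (v \in E h) = (h == i) || (h == l).
    case: (ltngtP i l) => [il|il|il]; first exact: wit.
      by have [v vP] := wit _ _ il; exists v => h; rewrite vP orbC.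
    by case/eqP: li; apply: val_inj.
  have := wv j; rewrite -Eij wv eqxx /= => /esym/orP[/eqP ji|/eqP jl].
    by rewrite ji ltnn in lt_ij.
  by rewrite jl eqxx in lj.
have Einj : injective E.
  move=> i j Eij; apply: val_inj; case: (ltngtP i j) => // [/ltE|/ltE].
    by rewrite Eij eqxx.
  by rewrite Eij eqxx.
rewrite -{1}(card_ord k) -(card_imset _ Einj).
by apply: subset_leq_card; apply/subsetP => _ /imsetP[i _ ->].
Qed.

Definition lambda : nat := ex_maxn lambda_cand_ex lambda_cand_bounded.

End Lambda.

(* Main.v *)
Require Import Defs.
From HB Require Import structures.
From mathcomp Require Import all_boot.
From mathcomp Require Import zify.

(** Put m = uphalf t.+1, so that t <= 2m + 1.  Among more than C(p,q) * m
    hyperedges X(Z_i), the pigeonhole principle gives m + 1 whose sets Z_i lie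
    in distinct components of G|Y.  Order them as Z_0, ..., Z_m; the sets
    Z_0, {v_{0,1}}, Z_1, {v_{1,2}}, ..., Z_m are then connected, and edges only
    join equal or consecutive ones.  A shortest path from the first to the last
    set is induced and meets all 2m + 1 of them. *)

(** * Induced paths from shortest walks *)

Section InducedPaths.
Variables (V : finType) (e : rel V).
Hypotheses (e_sym : symmetric e) (e_irr : irreflexive e).

(** A shortest walk from [a] to [b] inside [W] has no chord and no repeated vertex. Since [lev]
    rises by at most one per edge, it has at least [lev b - lev a] edges, so its first [t] vertices
    induce the path. *)
Lemma has_induced_path_graph_lipschitz (t : nat) (W : {set V}) (lev : V -> nat)
    (a b : V) :
  connect (restr e W) a b ->
  {in W &, forall x y, e x y -> lev y <= (lev x).+1} ->
  t <= (lev b - lev a).+1 -> has_induced e (@path_graph t).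
Proof.
move=> cab lip tle.
pose P n := [exists s : n.-tuple V, path (restr e W) a s && (last a s == b)].
have exP : exists n, P n.
  case/connectP: cab => s ps bE.
  by exists (size s); apply/existsP; exists (in_tuple s); rewrite ps bE eqxx.
case: (ex_minnP exP) => n /existsP[[s /= /eqP sz] /andP[ps /eqP sb]] minn.
have levp u x : path (restr e W) x u -> lev (last x u) <= lev x + size u.
  elim: u x => [|y u IH] x /=; first by rewrite addn0.
  case/andP=> /and3P[xW yW exy] /IH; have := lip _ _ xW yW exy; lia.
have tn : t <= n.+1 by have := levp _ _ ps; rewrite sb sz; lia.
(* [s] restricts to a shortest path to each of its vertices. *)
have short i u : i <= n -> path (restr e W) a u ->
    last a u = nth a (a :: s) i -> i <= size u.
  move=> i_n pu lu; have takei : last a (take i s) = nth a (a :: s) i.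
    case: i i_n {lu} => [|i] i_n; first by rewrite take0.
    by rewrite (last_nth a) size_takel ?sz //= nth_take.
  (* Replacing the first [i] steps of [s] by [u] gives another walk to [b], whose length is at least
     [n]. *)
  have: P (size (u ++ drop i s)).
    apply/existsP; exists (in_tuple (u ++ drop i s)) => /=.
    rewrite cat_path pu lu -takei last_cat lu -takei -last_cat cat_take_drop sb.
    by move: ps; rewrite -{1}(cat_take_drop i s) cat_path => /andP[_ ->] /=.
  by move/minn; rewrite size_cat size_drop sz; lia.
have pti i : path (restr e W) a (take i s).
  by move: ps; rewrite -{1}(cat_take_drop i s) cat_path => /andP[].
have lti i : i <= n -> last a (take i s) = nth a (a :: s) i.
  case: i => [|i] i_n; first by rewrite take0.
  by rewrite (last_nth a) size_takel ?sz //= nth_take.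
have stepi i : i < n ->
    restr e W (nth a (a :: s) i) (nth a (a :: s) i.+1).
  by move=> i_n; move/pathP: ps => /(_ a i); rewrite sz => /(_ i_n).
(* Membership in [W] is read off the steps of the walk; with no step, [a] itself may lie outside
   [W]. *)
have inW i : 0 < n -> i <= n -> nth a (a :: s) i \in W.
  move=> n0 i_n; case: (ltnP i n) => [/stepi/and3P[] //|ni].
  have -> : i = i.-1.+1 by lia.
  by have /stepi/and3P[] : i.-1 < n by lia.
have adj i j : i < j <= n -> e (nth a (a :: s) i) (nth a (a :: s) j) = (j == i.+1).
  move=> /andP[ij jn]; apply/idP/eqP => [eij|->]; last first.
    have i_n : i < n by lia.
    by case/and3P: (stepi i i_n).
  have i_n : i <= n by lia.
  (* A chord from position [i] to position [j] would reach the latter in [i.+1] steps. *)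
  have := short j (rcons (take i s) (nth a (a :: s) j)) jn.
  rewrite rcons_path pti lti //= last_rcons size_rcons size_takel ?sz //.
  have n0 : 0 < n by lia.
  by rewrite /restr /= eij !inW // => /(_ isT erefl); lia.
exists (fun i : 'I_t => nth a (a :: s) i).
  have lt_neq (i j : 'I_t) : i < j -> nth a (a :: s) i <> nth a (a :: s) j.
    move=> ij nij; have jt := ltn_ord j.
    have i_n : i <= n by lia.
    have j_n : j <= n by lia.
    have := short j (take i s) j_n (pti i); rewrite lti // nij size_takel ?sz //.
    by move/(_ erefl); lia.
  by move=> i j nij; apply: val_inj; case: (ltngtP i j) => // /lt_neq; rewrite nij.
move=> i j; have it := ltn_ord i; have jt := ltn_ord j; rewrite /path_graph /=.
case: (ltngtP i j) => [ij|ji|/val_inj->].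
- by rewrite adj; lia.
- by rewrite e_sym adj; lia.
- by rewrite e_irr; lia.
Qed.

Lemma connect_restr_sym (A : {set V}) : connect_sym (restr e A).
Proof.
apply: sym_connect_sym => x y.
by rewrite /restr /= e_sym; case: (x \in A); case: (y \in A).
Qed.

Lemma connect_restrS (A B : {set V}) (x y : V) :
  A \subset B -> connect (restr e A) x y -> connect (restr e B) x y.
Proof.
move=> /subsetP AB; apply: connect_sub => u v /and3P[uA vA euv].
by apply: connect1; rewrite /restr /= !AB.
Qed.

(** The level of a vertex is the first index of a set containing it: [far] bounds its growth along
    edges, and [b], lying in no earlier set, has level [n]. The sets may overlap. *)
Lemma has_induced_path_graph_chain (t n : nat) (c : nat -> {set V}) (b : V) :
  (forall i, i <= n -> induces_connected e (c i)) ->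
  (forall i, i < n -> exists x y, [/\ x \in c i, y \in c i.+1 & e x y]) ->
  (forall i j x y, i <= n -> j <= n -> x \in c i -> y \in c j -> e x y ->
    j <= i.+1) ->
  b \in c n -> (forall i, i < n -> b \notin c i) ->
  t <= n.+1 -> has_induced e (@path_graph t).
Proof.
move=> conn link far bn b_last tn.
pose W := \bigcup_(i < n.+1) c i.
have cW i : i <= n -> c i \subset W.
  by rewrite -ltnS => i_n; apply: (bigcup_sup (Ordinal i_n)).
(* The least [i <= n] with [x \in c i], and [n.+1] if there is none. *)
pose lev x := find (fun i => x \in c i) (iota 0 n.+1).
have lev_le i x : i <= n -> x \in c i -> lev x <= i.
  move=> i_n xi; rewrite leqNgt; apply/negP => /(before_find 0).
  by rewrite nth_iota // add0n xi.
have levP x : x \in W -> lev x <= n /\ x \in c (lev x).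
  case/bigcupP=> i _ xi; have i_n : i <= n by rewrite -ltnS.
  have lx := leq_trans (lev_le i x i_n xi) i_n; split=> //.
  have hx : has (fun i => x \in c i) (iota 0 n.+1).
    by apply/hasP; exists (i : nat); rewrite ?mem_iota.
  by have := nth_find 0 hx; rewrite -/(lev x) nth_iota.
have [a ac] : exists a, a \in c 0.
  case: n bn link {conn far b_last tn W cW lev lev_le levP} => [|n] bn link.
    by exists b.
  by have [x [y [xc _ _]]] := link 0 isT; exists x.
have reach i : i <= n -> {in c i, forall x, connect (restr e W) a x}.
  elim: i => [|i IH] i_n x xc; first exact: connect_restrS (cW _ i_n) (conn _ i_n _ _ ac xc).
  have [u [v [uc vc euv]]] := link _ i_n.
  apply: connect_trans (IH (ltnW i_n) u uc) _.
  apply: connect_trans (connect_restrS _ _ _ _ (cW _ i_n) (conn _ i_n _ _ vc xc)).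
  have uW := subsetP (cW _ (ltnW i_n)) u uc; have vW := subsetP (cW _ i_n) v vc.
  by apply: connect1; rewrite /restr /= uW vW.
apply: (has_induced_path_graph_lipschitz t W lev a b (reach n _ b bn)) => //.
  move=> x y /levP[lx xc] yW exy; have [ly yc] := levP y yW.
  exact: far exy.
have la : lev a <= 0 by apply: lev_le.
have lb : n <= lev b.
  have [_ blev] := levP b (subsetP (cW n (leqnn n)) b bn).
  by rewrite leqNgt; apply/negP => /b_last; rewrite blev.
lia.
Qed.

(** * Components of the graph induced on [Y] *)

(** For nonempty connected [Z] inside [Y], this is the component containing [Z], obtained without
    choosing a vertex of [Z]. *)
Definition hull (Y Z : {set V}) : {set V} :=
  [set y in Y | [exists z in Z, connect (restr e Y) z y]].

Lemma sub_hull (Y Z : {set V}) : Z \subset Y -> Z \subset hull Y Z.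
Proof.
move=> ZY; apply/subsetP => z zZ; rewrite inE (subsetP ZY) //=.
by apply/existsP; exists z; rewrite zZ connect0.
Qed.

Lemma hull_eq_class (Y Z : {set V}) (z : V) :
  Z \subset Y -> induces_connected e Z -> z \in Z ->
  hull Y Z = [set y in Y | connect (restr e Y) z y].
Proof.
move=> ZY Zc zZ; apply/setP => y; rewrite !inE; case: (y \in Y) => //=.
apply/existsP/idP => [[u /andP[uZ]]|zy]; last by exists z; rewrite zZ.
exact: connect_trans (connect_restrS _ _ _ _ ZY (Zc _ _ zZ uZ)).
Qed.

Lemma hull_component (Y Z : {set V}) (z : V) :
  Z \subset Y -> induces_connected e Z -> z \in Z ->
  hull Y Z \in components e Y.
Proof.
move=> ZY Zc zZ; rewrite (hull_eq_class _ _ _ ZY Zc zZ).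
by apply/imsetP; exists z => //; apply: (subsetP ZY).
Qed.

(** Used in contrapositive form: sets with distinct hulls are disjoint and no edge joins them. *)
Lemma eq_hull (Y Z Z' : {set V}) (z z' : V) :
  Z \subset Y -> induces_connected e Z -> z \in Z ->
  Z' \subset Y -> induces_connected e Z' -> z' \in Z' ->
  (z == z') || e z z' -> hull Y Z = hull Y Z'.
Proof.
move=> ZY Zc zZ ZY' Zc' zZ' zz'.
rewrite (hull_eq_class _ _ _ ZY Zc zZ) (hull_eq_class _ _ _ ZY' Zc' zZ').
have cz : connect (restr e Y) z z'.
  case/orP: zz' => [/eqP->|ezz]; first exact: connect0.
  by apply: connect1; rewrite /restr /= ezz (subsetP ZY) // (subsetP ZY').
by apply/setP => y; rewrite !inE (same_connect (connect_restr_sym Y) cz).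
Qed.

End InducedPaths.

Arguments hull {V} e Y Z.

(** * Pigeonhole counting and choice of representatives *)

Lemma card_le_imset_fibers (I T : finType) (h : I -> T) (m : nat) :
  (forall y, y \in h @: I -> #|[set i | h i == y]| <= m) ->
  #|I| <= m * #|h @: I|.
Proof.
move=> fib; have -> : #|I| = \sum_(y in h @: I) \sum_(i in I | h i == y) 1.
  by rewrite -sum1_card; apply: (partition_big_imset h I (fun=> 1)).
rewrite mulnC -sum_nat_const.
apply: leq_sum => y /fib; apply: leq_trans.
by rewrite sum1_card; apply/eq_leq/eq_card => i; rewrite !inE.
Qed.

(** Indexing by [nat] lets consecutive choices be written [s i] and [s i.+1] without casts; values
    beyond [m] carry no information. *)
Lemma imset_section (I T : finType) (h : I -> T) (m : nat) :
  m < #|h @: I| ->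
  exists s : nat -> I,
    forall i j, i <= m -> j <= m -> h (s i) = h (s j) -> i = j.
Proof.
move=> m_lt; have [y0 y0h] : exists y, y \in h @: I.
  by apply/card_gt0P; apply: leq_trans m_lt.
have [i0 _ _] := imsetP y0h.
pose cs := enum (h @: I).
exists (fun j => odflt i0 [pick i | h i == nth y0 cs j]).
have hs j : j <= m -> h (odflt i0 [pick i | h i == nth y0 cs j]) = nth y0 cs j.
  move=> jm; case: pickP => [i /eqP //|none].
  have : nth y0 cs j \in h @: I.
    by rewrite -mem_enum mem_nth // -cardE (leq_ltn_trans jm).
  by case/imsetP=> i _ ih; have := none i; rewrite ih eqxx.
move=> i j im jm; rewrite !hs // => /eqP.
rewrite nth_uniq ?enum_uniq -?cardE ?(leq_ltn_trans im) ?(leq_ltn_trans jm) //.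
by move/eqP.
Qed.

(** * Hyperedges with pairwise witnesses *)

Lemma pairwise_witnessedP {V : finType} {H : hypergraph V} {k : nat} :
  pairwise_witnessed H k ->
  exists2 E : 'I_k -> {set V}, forall i, E i \in hedges H &
    forall a b, a != b -> exists2 v, v \in hverts H &
      forall h, (v \in E h) = (h == a) || (h == b).
Proof.
case/existsP=> E /andP[/forallP EH /forallP w]; exists E => // a b.
have wit (i j : 'I_k) : i < j -> exists2 v, v \in hverts H &
    forall h, (v \in E h) = (h == i) || (h == j).
  move=> ij; have /forallP/(_ j)/implyP/(_ ij)/existsP[v /andP[vH /eqP vE]] := w i.
  by exists v => // h; move/setP/(_ h): vE; rewrite !inE.
move=> ab; case: (ltngtP a b) => [/wit //|/wit[v vH vE]|/val_inj abE].
  by exists v => // h; rewrite vE orbC.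
by rewrite abE eqxx in ab.
Qed.

(** With a third index [l], the witness of [a] and [l] lies in [E a] but not in [E b]. *)
Lemma witnessed_inj (V : finType) (k : nat) (E : 'I_k -> {set V}) :
  2 < k ->
  (forall a b, a != b -> exists v, forall h, (v \in E h) = (h == a) || (h == b)) ->
  injective E.
Proof.
move=> k_gt2 w a b Eab; apply/eqP/negPn/negP => ab.
have /card_gt0P[l] : 0 < #|~: [set a; b]|.
  by have := cardsC [set a; b]; rewrite cards2 ab card_ord; lia.
rewrite !inE negb_or => /andP[la lb].
have [v vE] : exists v, forall h, (v \in E h) = (h == a) || (h == l).
  by apply: w; rewrite eq_sym.
have := vE b; rewrite -Eab vE eqxx /= => /esym.
by rewrite [b == l]eq_sym (negPf lb) orbF eq_sym (negPf ab).
Qed.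

Theorem theorem2p5 (t p q : nat) (V : finType) (e : rel V)
  (e_sym : symmetric e) (e_irr : irreflexive e)
  (G_free : path_free e t)
  (X Y : {set V})
  (XY_disj : [disjoint X & Y])
  (X_stable : stable e X)
  (Y_comp : forall C, C \in components e Y -> #|C| <= p)
  (ZZ : {set {set V}})
  (ZZ_sub : forall Z, Z \in ZZ -> Z \subset Y)
  (ZZ_size : forall Z, Z \in ZZ -> #|Z| = q)
  (ZZ_conn : forall Z, Z \in ZZ -> induces_connected e Z)
  (ZZ_attach : forall Z, Z \in ZZ -> attach e X Z != set0)
  (* For an empty family, lambda is 2 by convention, while the bound may be
     0 or 1 (when q > p, or when t = 1 and binomial(p, q) = 1). *)
  (ZZ_empty : ZZ = set0 -> 2 <= 'C(p, q) * uphalf t.+1)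
  (H : hypergraph V)
  (H_verts : hverts H = X)
  (H_edges : hedges H = [set attach e X Z | Z in ZZ]) :
  (* uphalf n is the ceiling of n / 2 *)
  lambda H <= 'C(p, q) * uphalf t.+1.
Proof.
have attachP Z v : v \in attach e X Z -> v \in X /\ exists2 u, u \in Z & e v u.
  by rewrite !inE => /and3P[vX _ /existsP[u /andP[uZ evu]]]; split=> //; exists u.
have ne Z : Z \in ZZ -> exists z, z \in Z.
  move=> /ZZ_attach/set0Pn[v /attachP[_ [u uZ _]]]; by exists u.
have hull_le Z : Z \in ZZ -> #|hull e Y Z| <= p.
  move=> ZZZ; have [z zZ] := ne Z ZZZ; apply: Y_comp.
  by apply: (hull_component _ _ _ _ z); rewrite ?ZZ_sub //; apply: ZZ_conn.
(* This settles the default value 2 of [lambda] and later gives [2 < k]. A member of [ZZ] lies in a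
   component, so [q <= p] and the binomial is positive. *)
have two_le : 2 <= 'C(p, q) * uphalf t.+1.
  case: (set_0Vmem ZZ) => [/ZZ_empty //|[Z ZZZ]].
  have /set0Pn[v _] := ZZ_attach Z ZZZ.
  have binp : 0 < 'C(p, q).
    rewrite bin_gt0 -(ZZ_size Z ZZZ) (leq_trans _ (hull_le Z ZZZ)) //.
    by apply: subset_leq_card; apply: sub_hull; apply: ZZ_sub.
  have t2 : 1 < t.
    (* For [t <= 1] a constant map already embeds the path. *)
    rewrite ltnNge; apply/negP => t1; apply: G_free; exists (fun=> v) => i j.
      by move=> _; apply: val_inj => /=; have := ltn_ord i; have := ltn_ord j; lia.
    rewrite e_irr /path_graph /=; have := ltn_ord i; have := ltn_ord j; lia.
  by rewrite (leq_trans _ (leq_pmull _ binp)) //; lia.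
rewrite /lambda; case: ex_maxnP => k k_cand _.
case/orP: k_cand => [/eqP-> //|/andP[k2 /pairwise_witnessedP[E EH wit]]].
rewrite leqNgt; apply/negP => k_big; apply: G_free.
have k_gt2 : 2 < k by apply: leq_ltn_trans two_le k_big.
have E_inj : injective E.
  by apply: (witnessed_inj _ _ _ k_gt2) => a b /wit[v _ vE]; exists v.
have [Zf ZfZZ ZfE] :
    exists2 Zf : 'I_k -> {set V}, forall i, Zf i \in ZZ &
      forall i, E i = attach e X (Zf i).
  apply: (fin_all_exists2 (U := fun=> {set V}) (P := fun _ Z => Z \in ZZ)
    (Q := fun i Z => E i = attach e X Z)) => i; have := EH i; rewrite H_edges => /imsetP[Z].
  by exists Z.
have Zf_inj : injective Zf.
  by move=> i j Zij; apply: E_inj; rewrite !ZfE Zij.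
pose K i := hull e Y (Zf i).
(* The sets [Zf i] with hull [C] are distinct [q]-subsets of a set of at most [p] vertices. *)
have K_fib C : C \in K @: 'I_k -> #|[set i | K i == C]| <= 'C(p, q).
  case/imsetP=> i _ ->; rewrite -(card_imset _ Zf_inj).
  apply: (@leq_trans 'C(#|K i|, q)); last by apply: leq_bin2l; apply: hull_le.
  rewrite -cards_draws; apply: subset_leq_card.
  apply/subsetP=> _ /imsetP[j + ->]; rewrite !inE ZZ_size // eqxx andbT.
  by move/eqP <-; apply: sub_hull; apply: ZZ_sub.
have [s s_inj] : exists s : nat -> 'I_k, forall i j, i <= uphalf t.+1 ->
    j <= uphalf t.+1 -> K (s i) = K (s j) -> i = j.
  apply: imset_section; rewrite ltnNge; apply/negP => small.
  have := leq_trans (card_le_imset_fibers _ _ _ _ K_fib) (leq_mul (leqnn _) small).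
  by rewrite card_ord leqNgt k_big.
set m := uphalf t.+1 in k_big s_inj.
have Z_far i j y z : i <= m -> j <= m -> y \in Zf (s i) -> z \in Zf (s j) ->
    (y == z) || e y z -> i = j.
  move=> im jm yZ zZ yz; apply: s_inj => //.
  by apply: (eq_hull _ _ e_sym _ _ _ y z) yz => //; rewrite ?ZZ_sub //; apply: ZZ_conn.
have [x xP] : exists x : 'I_m -> V, forall i : 'I_m, x i \in X /\
    forall h, (x i \in E h) = (h == s i) || (h == s i.+1).
  apply: (fin_all_exists (U := fun=> V) (P := fun (i : 'I_m) v => v \in X /\
    forall h, (v \in E h) = (h == s i) || (h == s i.+1))) => i; have im := ltn_ord i.
  have [|v vX vE] := wit (s i) (s i.+1); last by exists v; rewrite -H_verts.
  by apply/eqP => /(congr1 K)/(s_inj _ _ (ltnW im) im)/n_Sn.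
(* Even positions carry the chosen sets, odd ones the singletons of the witnesses. The image form is
   used because [x] is defined on ['I_m] only. *)
pose c l := if odd l then [set x i | i : 'I_m & i == l./2 :> nat] else Zf (s l./2).
have cX l y : odd l -> y \in c l -> exists2 i : 'I_m, l = i.*2.+1 & y = x i.
  rewrite /c => lo; rewrite lo => /imsetP[i]; rewrite inE => /eqP il ->.
  by exists i => //; lia.
have c_odd (i : 'I_m) : x i \in c i.*2.+1.
  by rewrite /c /= odd_double /= uphalf_double; apply/imsetP; exists i; rewrite ?inE.
have c_even i : c i.*2 = Zf (s i) by rewrite /c odd_double doubleK.
(* A neighbor of [x i] in [Zf (s j)] puts [x i] in [E (s j)], and the witness property leaves two
   indices. *)
have Zx (i : 'I_m) j z : j <= m -> z \in Zf (s j) -> e (x i) z ->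
    j = i \/ j = i.+1.
  move=> jm zZ exz; have [xX xE] := xP i; have im := ltn_ord i.
  have : x i \in E (s j).
    rewrite ZfE !inE xX /=; apply/andP; split.
      apply/negP => /(subsetP (ZZ_sub _ (ZfZZ _))).
      by apply/negP; rewrite (disjointFr XY_disj xX).
    by apply/existsP; exists z; rewrite zZ.
  rewrite xE => /orP[] /eqP/(congr1 K)/s_inj; [left|right]; lia.
have [b bZ] := ne _ (ZfZZ (s m)).
apply: (has_induced_path_graph_chain _ _ e_sym e_irr t m.*2 c b).
- move=> l lm; case: (boolP (odd l)) => lo; last first.
    by rewrite /c (negPf lo); apply: ZZ_conn.
  move=> _ _ /(cX _ _ lo)[i li ->] /(cX _ _ lo)[j lj ->].
  have /val_inj-> : (i : nat) = j by lia.
  exact: connect0.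
- move=> l lm; case: (boolP (odd l)) => lo.
    have im : l./2 < m by lia.
    pose i := Ordinal im; have [_ xE] := xP i.
    have : x i \in E (s i.+1) by rewrite xE eqxx orbT.
    rewrite ZfE => /attachP[_ [u uZ exu]]; exists (x i), u; split=> //.
      have -> : l = i.*2.+1 by rewrite /=; lia.
      exact: c_odd.
    have -> : l.+1 = i.+1.*2 by rewrite /=; lia.
    by rewrite c_even.
  have im : l./2 < m by lia.
  pose i := Ordinal im; have [_ xE] := xP i.
  have : x i \in E (s i) by rewrite xE eqxx.
  have lE : l = i.*2 by rewrite /=; lia.
  rewrite ZfE => /attachP[_ [u uZ exu]]; exists u, (x i).
  by rewrite lE c_even e_sym; split=> //; apply: c_odd.
(* By parity: two witnesses are non-adjacent as [X] is stable, a witness and a set obey [Zx], and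
   two sets obey [Z_far]. *)
- move=> l r y z lm rm yc zc eyz.
  case: (boolP (odd l)) yc => lo yc; case: (boolP (odd r)) zc => ro zc.
  + case/(cX _ _ lo): yc eyz => i _ ->; case/(cX _ _ ro): zc => j _ ->.
    by rewrite (negPf (X_stable _ _ (xP i).1 (xP j).1)).
  + case/(cX _ _ lo): yc eyz => i -> -> exz.
    move: zc; rewrite /c (negPf ro) => zc.
    have rm2 : r./2 <= m by lia.
    by have [] := Zx _ _ _ rm2 zc exz; lia.
  + case/(cX _ _ ro): zc eyz => i -> ->; rewrite e_sym => exy.
    move: yc; rewrite /c (negPf lo) => yc.
    have lm2 : l./2 <= m by lia.
    by have [] := Zx _ _ _ lm2 yc exy; lia.
  + move: yc zc; rewrite /c (negPf lo) (negPf ro) => yc zc.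
    have lm2 : l./2 <= m by lia.
    have rm2 : r./2 <= m by lia.
    have := Z_far _ _ _ _ lm2 rm2 yc zc; rewrite eyz orbT => /(_ isT); lia.
- by rewrite c_even.
(* Odd positions lie in [X], disjoint from [Y]; earlier even ones lie in other components than
   [b]. *)
- move=> l lm; apply/negP => bc; case: (boolP (odd l)) => lo.
    have [i _ bx] := cX _ _ lo bc; have := disjointFr XY_disj (xP i).1.
    by rewrite -bx (subsetP (ZZ_sub _ (ZfZZ _)) _ bZ).
  move: bc; rewrite /c (negPf lo) => bc.
  have lm2 : l./2 <= m by lia.
  have := Z_far _ _ _ _ lm2 (leqnn m) bc bZ; rewrite eqxx => /(_ isT); lia.
- rewrite /m; lia.
Qed.
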